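(* Let $R_i(t)\subseteq\mathbb{R}^n$ and projection functions $P_i$ ($i=1,\dots,N$, $t=1,\dots,T$) be any reachable sets and projection functions such that (a) whenever $P_i(x_i,\mathcal{E}_i,t)$ returns a point (and not $\neg$), it satisfies $P_i(x_i,\mathcal{E}_i,t)\in x_i(t)+R_i(t)$ and $P_i(x_i,\mathcal{E}_i,t)\notin x_j(t)+R_j(t)$ for all $j\neq i$; (b) $R_i(t)$ is compact for each agent $i$ and each time $t$; (c) $0\in R_i(t)$ for each agent $i$ and each time $t$. If every agent uses the projection algorithm described in the context and all agents start from a collision-free configuration ($x_i(1)\ne x_j(1)$ for $i\neq j$), then no collision occurs: $\|x_i(t)-x_j(t)\|_2>0$ for all $i\ne j$ and all $t=1,\dots,T$.
   Context: There are $N$ agents; $x_i(t)\in\mathbb{R}^n$ is the position of agent $i$ at discrete time $t$. To each agent $i$ and time $t$ is associated a reachable set $R_i(t)\subseteq\mathbb{R}^n$, expressed relative to the current position; $v+M=\{v+w:w\in M\}$ for a vector $v$ and a set $M$. A projection function $P_i(x_i,\mathcal{E}_i,t)$ is any rule that, at time $t$, returns either a point of $\mathbb{R}^n$ or a symbol $\neg$ (meaning ''no safe point to move to''). It may depend on agent $i$'s position and on agent $i$'s uncertainty sets $\mathcal{E}_i$ about the other agents (including their history); no requirement of accuracy or boundedness is placed on these uncertainty sets. Projection algorithm (run simultaneously by all agents): for $t=1,\dots,T$, compute $q=P_i(x_i,\mathcal{E}_i,t)$; if $q=\neg$ set $x_i(t+1)=x_i(t)$; otherwise set $x_i(t+1)=q$.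 *)

(* Defs.v *)
From HB Require Import structures.
From mathcomp Require Import all_boot all_order all_algebra.
From mathcomp Require Import all_classical all_reals all_analysis.

Set Implicit Arguments.
Unset Strict Implicit.
Unset Printing Implicit Defensive.

Import Order.TTheory GRing.Theory Num.Theory.
Import numFieldNormedType.Exports.

Local Open Scope classical_set_scope.
Local Open Scope ring_scope.

(* The library norm on row vectors is the sup norm, hence this definition. *)
Definition l2norm (R : realType) (n : nat) (v : 'rV[R]_n) : R :=
  Num.sqrt (\sum_(k < n) v 0 k ^+ 2).

Definition translate (R : realType) (n : nat) (v : 'rV[R]_n)
    (M : set 'rV[R]_n) : set 'rV[R]_n :=
  [set v + w | w in M].

(* The uncertainty sets held by one agent: [E j s] is its uncertainty set for
   the position of agent [j] at time [s], so that histories are included.  The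
   entry for the agent itself carries no meaning, and no entry is constrained. *)
Definition uncertainty (R : realType) (n N : nat) : Type :=
  'I_N -> nat -> set 'rV[R]_n.

(* [None] encodes the symbol "no safe point to move to". *)
Definition projection_function (R : realType) (n N : nat) : Type :=
  'rV[R]_n -> uncertainty R n N -> nat -> option 'rV[R]_n.

(* [x i t] is the position of agent [i] at time [t], and [E i t] the uncertainty
   sets that agent [i] holds at time [t].  Times run from 1, so [x i 0] is
   unused; the last step produces [x i T.+1]. *)
Definition projection_algorithm (R : realType) (n N T : nat)
    (P : 'I_N -> projection_function R n N)
    (E : 'I_N -> nat -> uncertainty R n N)
    (x : 'I_N -> nat -> 'rV[R]_n) : Prop :=
  forall (i : 'I_N) (t : nat), (1 <= t <= T)%N ->
    x i t.+1 = if P i (x i t) (E i t) t is Some q then q else x i t.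

(* Main.v *)
Require Import Defs.
From HB Require Import structures.
From mathcomp Require Import all_boot all_order all_algebra.
From mathcomp Require Import all_classical all_reals all_analysis.

Set Implicit Arguments.
Unset Strict Implicit.
Unset Printing Implicit Defensive.

Import Order.TTheory GRing.Theory Num.Theory.
Import numFieldNormedType.Exports.
Local Open Scope classical_set_scope.
Local Open Scope ring_scope.

(** Collisions are excluded one step at a time.  Since [0] is reachable, agent
    [j] lies in its own current set [x j t + Rch j t] at time [t.+1] whether it
    moves or waits ([next_reachable]).  A moving agent [i] picks a point outside
    that set, so it cannot meet [j] wherever [j] ends up ([mover_avoids]).  By
    symmetry two agents can coincide at time [t.+1] only if both waited, hence
    only if they already coincided at time [t]; induction on time concludes. *)

Lemma l2norm_gt0 (R : realType) (n : nat) (v : 'rV[R]_n) :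
  v != 0 -> 0 < l2norm v.
Proof.
move=> v0; rewrite /l2norm sqrtr_gt0 lt_neqAle eq_sym.
rewrite sumr_ge0 ?andbT => [|k _]; last exact: sqr_ge0.
apply: contra v0 => /eqP sum0; apply/eqP/rowP => k; rewrite mxE.
have /(_ k isT)/eqP := psumr_eq0P (fun k _ => sqr_ge0 (v 0 k)) sum0.
by rewrite sqrf_eq0 => /eqP.
Qed.

Lemma translate_base (R : realType) (n : nat) (v : 'rV[R]_n)
    (M : set 'rV[R]_n) : M 0 -> translate v M v.
Proof. by move=> M0; exists 0; rewrite ?addr0. Qed.

Lemma next_reachable (R : realType) (n N T : nat)
    (Rch : 'I_N -> nat -> set 'rV[R]_n)
    (P : 'I_N -> projection_function R n N)
    (E : 'I_N -> nat -> uncertainty R n N)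
    (x : 'I_N -> nat -> 'rV[R]_n) (i : 'I_N) (t : nat) :
  projection_algorithm T P E x -> (1 <= t <= T)%N -> Rch i t 0 ->
  (forall q, P i (x i t) (E i t) t = Some q -> translate (x i t) (Rch i t) q) ->
  translate (x i t) (Rch i t) (x i t.+1).
Proof.
move=> run tT R0 Preach; rewrite (run i t tT).
by case Pit: P => [q|]; [exact: Preach | exact: translate_base].
Qed.

(** Which move [j] makes at the same time is irrelevant: the point [q] avoids
    every point that [j] can reach. *)
Lemma mover_avoids (R : realType) (n N T : nat)
    (Rch : 'I_N -> nat -> set 'rV[R]_n)
    (P : 'I_N -> projection_function R n N)
    (E : 'I_N -> nat -> uncertainty R n N)
    (x : 'I_N -> nat -> 'rV[R]_n) (i j : 'I_N) (t : nat) (q : 'rV[R]_n) :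
  projection_algorithm T P E x -> (1 <= t <= T)%N ->
  P i (x i t) (E i t) t = Some q -> ~ translate (x j t) (Rch j t) q ->
  translate (x j t) (Rch j t) (x j t.+1) ->
  x i t.+1 != x j t.+1.
Proof.
move=> run tT Pit qNj xj; rewrite (run i t tT) Pit.
by apply: contra_notN qNj => /eqP ->.
Qed.

Theorem mainTheorem2 (R : realType) (n N T : nat)
    (Rch : 'I_N -> nat -> set 'rV[R]_n)
    (P : 'I_N -> projection_function R n N)
    (E : 'I_N -> nat -> uncertainty R n N)
    (x : 'I_N -> nat -> 'rV[R]_n)
    (Psafe : forall (i : 'I_N) (t : nat) (q : 'rV[R]_n), (1 <= t <= T)%N ->
       P i (x i t) (E i t) t = Some q ->
       translate (x i t) (Rch i t) q /\
       (forall j : 'I_N, j != i -> ~ translate (x j t) (Rch j t) q))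
    (Rch_compact : forall (i : 'I_N) (t : nat), (1 <= t <= T)%N ->
       compact (Rch i t))
    (Rch0 : forall (i : 'I_N) (t : nat), (1 <= t <= T)%N -> Rch i t 0)
    (run : projection_algorithm T P E x)
    (start : forall i j : 'I_N, i != j -> x i 1%N != x j 1%N) :
  forall (i j : 'I_N) (t : nat), i != j -> (1 <= t <= T)%N ->
    0 < l2norm (x i t - x j t).
Proof.
move=> i j t ij tT; apply: l2norm_gt0; rewrite subr_eq0.
have reach k s : (1 <= s <= T)%N ->
    translate (x k s) (Rch k s) (x k s.+1).
  move=> sT; apply: (next_reachable run sT (Rch0 k s sT)) => q Pks.
  exact: (Psafe k s q sT Pks).1.
elim: t tT => [//|[|t] IHt] tT; first exact: start.
have tT' : (1 <= t.+1 <= T)%N by exact: ltnW.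
case Pi: (P i (x i t.+1) (E i t.+1) t.+1) => [q|].
  apply: (mover_avoids run tT' Pi _ (reach j _ tT')).
  by apply: (Psafe i _ q tT' Pi).2; rewrite eq_sym.
case Pj: (P j (x j t.+1) (E j t.+1) t.+1) => [q|].
  rewrite eq_sym; apply: (mover_avoids run tT' Pj _ (reach i _ tT')).
  exact: (Psafe j _ q tT' Pj).2.
(* Both agents wait. *)
by rewrite (run i _ tT') (run j _ tT') Pi Pj IHt.
Qed.
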